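(* Let $\alpha>1$ and let $L_2(\alpha)=\{\alpha^n : n\in\mathbb{N}_0\}^2\subseteq\mathbb{R}^2$. Then \[h(L_2(\alpha))\le 2\left\lceil\log_{\alpha}\left(\frac{\alpha}{\alpha-1}\right)\right\rceil+3.\]
   Context: For a set $S\subseteq\mathbb{R}^d$, the Helly number $h(S)$ is the smallest $h$ such that the following holds: for every finite family $\mathcal{F}$ of convex sets in $\mathbb{R}^d$, if every $h$ or fewer sets of $\mathcal{F}$ have a point of $S$ in their intersection, then the intersection of all sets of $\mathcal{F}$ contains a point of $S$. If no such $h$ exists, $h(S)=\infty$. Here $\mathbb{N}_0=\{0,1,2,\dots\}$. *)

(* Defs.v *)
From Stdlib Require Import Reals Lra List ZArith.
Open Scope R_scope.

Definition point := (R * R)%type.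
Definition pset := point -> Prop.

Definition comb (t : R) (x y : point) : point :=
  ((1 - t) * fst x + t * fst y, (1 - t) * snd x + t * snd y).

Definition convex (C : pset) : Prop :=
  forall x y t, C x -> C y -> 0 <= t <= 1 -> C (comb t x y).

Definition meets (S : pset) (G : list pset) : Prop :=
  exists p, S p /\ forall C, In C G -> C p.

Definition helly_property (S : pset) (h : nat) : Prop :=
  forall F : list pset, (forall C, In C F -> convex C) ->
    (forall G : list pset, incl G F -> (length G <= h)%nat -> meets S G) ->
    meets S F.

(* h is the Helly number of S (the smallest h with the Helly property);
   h(S) = infinity corresponds to no such h existing. *)
Definition is_helly_number (S : pset) (h : nat) : Prop :=
  helly_property S h /\ forall h', helly_property S h' -> (h <= h')%nat.

Definition L2 (alpha : R) : pset :=
  fun p => exists m n : nat, p = (alpha ^ m, alpha ^ n).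

Definition logb (b x : R) : R := ln x / ln b.

(* ceiling: Int_part is the floor in Stdlib *)
Definition Rceil (x : R) : Z := (- Int_part (- x))%Z.

(* Main.v *)
(* Helly reduction: a minimal family missing S yields points p_1, ..., p_m of S such that the hulls
   of P minus one point have no common point in S. Replacing some p_j by a point q of S in hull P,
   chosen outside as few of those hulls as possible, preserves this property and shrinks
   the intersection of S with hull P; in the end P is in convex position and hull P contains no
   other point of S. Hence the Helly number is at most the maximal size of such a hollow P.

   Hollow sets of (alpha^m, alpha^n): in logarithms (m, n) with homogeneous coordinates
   [0 : m : n], convexity is invariant under permuting the three coordinates. Triangles of P contain
   no lattice neighbour of their vertices, which forces, once |P| > 4 and up to this symmetry, any
   two points of P to be lattice neighbours or to lie strictly north-west and south-east of each
   other. Let k be the ceiling in the bound, so that alpha^(-k) <= 1 - 1/alpha, and let M be the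
   largest abscissa. Each column has at most two points, so the last k columns have at most 2k. The
   points with m <= M - k lie in the two top rows, since otherwise a segment from the top point
   to the rightmost one passes above a lattice point of their column; they cannot fill both
   rows with two points each, so there are at most three of them. *)
Require Import Defs.
From Stdlib Require Import Reals ZArith Lra Lia List Classical ClassicalEpsilon.
Import ListNotations.
Open Scope R_scope.

(** * Convex hulls in the plane and the anti-exchange property *)

Definition hull (A : pset) : pset :=
  fun p => forall C, convex C -> (forall a, A a -> C a) -> C p.

Definition del (P : list point) (q : point) : pset := fun p => In p P /\ p <> q.

Lemma hull_base (A : pset) (p : point) : A p -> hull A p.
Proof. intros Hp C _ HA; auto. Qed.

Lemma hull_convex (A : pset) : convex (hull A).
Proof. intros x y t Hx Hy Ht C HC HA; apply HC; [apply Hx | apply Hy |]; auto. Qed.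

Lemma hull_le (A B : pset) (p : point) :
  (forall a, A a -> hull B a) -> hull A p -> hull B p.
Proof. intros HAB Hp; apply Hp; [apply hull_convex | exact HAB]. Qed.

Lemma hull_mono (A B : pset) (p : point) :
  (forall a, A a -> B a) -> hull A p -> hull B p.
Proof. intros HAB; apply hull_le; intros a Ha; apply hull_base; auto. Qed.

(** The total weight off [p] is [w]. When it is positive, dividing the weights of [a] and [b] by [w]
    gives the point of the segment [ab] to which [p] is joined. *)
Lemma comb_cone (p a b : point) (t s u : R) :
  0 <= t <= 1 -> 0 <= s <= 1 -> 0 <= u <= 1 ->
  comb u (comb t p a) (comb s p b) = p \/
  exists c w, 0 <= c <= 1 /\ 0 <= w <= 1 /\
    comb u (comb t p a) (comb s p b) = comb w p (comb c a b).
Proof.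
  intros Ht Hs Hu.
  set (w := (1 - u) * t + u * s).
  assert (H1 : 0 <= (1 - u) * t) by (apply Rmult_le_pos; lra).
  assert (H2 : 0 <= u * s) by (apply Rmult_le_pos; lra).
  destruct p as [p1 p2], a as [a1 a2], b as [b1 b2]; unfold comb; simpl.
  destruct (Req_dec w 0) as [H0 | H0].
  - left; unfold w in H0.
    assert (E1 : (1 - u) * t = 0) by lra.
    assert (E2 : u * s = 0) by lra.
    f_equal.
    + transitivity (p1 + ((1 - u) * t) * (a1 - p1) + (u * s) * (b1 - p1)); [ring |].
      rewrite E1, E2; ring.
    + transitivity (p2 + ((1 - u) * t) * (a2 - p2) + (u * s) * (b2 - p2)); [ring |].
      rewrite E1, E2; ring.
  - right; exists (u * s / w), w.
    assert (Hw : 0 < w) by (unfold w in *; lra).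
    assert (Hw1 : w <= 1) by (unfold w; nra).
    repeat split; try lra.
    + apply Rmult_le_reg_r with w; [lra |].
      replace (u * s / w * w) with (u * s) by (field; lra); lra.
    + apply Rmult_le_reg_r with w; [lra |].
      replace (u * s / w * w) with (u * s) by (field; lra); unfold w; lra.
    + f_equal.
      * replace ((1 - w) * p1 + w * ((1 - u * s / w) * a1 + u * s / w * b1))
          with ((1 - w) * p1 + (w - u * s) * a1 + u * s * b1) by (field; lra).
        unfold w; ring.
      * replace ((1 - w) * p2 + w * ((1 - u * s / w) * a2 + u * s / w * b2))
          with ((1 - w) * p2 + (w - u * s) * a2 + u * s * b2) by (field; lra).
        unfold w; ring.
Qed.

(** The point [p] together with all segments from [p] to [hull A] forms a convex set by [comb_cone].
    It contains [A] and [p], hence the whole hull. *)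
Lemma hull_insert (A : pset) (p q : point) :
  hull (fun a => A a \/ a = p) q ->
  q = p \/ exists a t, hull A a /\ 0 <= t <= 1 /\ q = comb t p a.
Proof.
  intros Hq.
  apply (Hq (fun q => q = p \/ exists a t, hull A a /\ 0 <= t <= 1 /\ q = comb t p a)).
  - assert (H0 : forall a, p = comb 0 p a)
      by (intros a; destruct p; unfold comb; simpl; f_equal; ring).
    assert (HJ : forall a b t s u, hull A a -> hull A b ->
      0 <= t <= 1 -> 0 <= s <= 1 -> 0 <= u <= 1 ->
      comb u (comb t p a) (comb s p b) = p \/
      exists c w, hull A c /\ 0 <= w <= 1 /\
        comb u (comb t p a) (comb s p b) = comb w p c).
    { intros a b t s u Ha Hb Ht Hs Hu.
      destruct (comb_cone p a b t s u Ht Hs Hu) as [E | (c & w & Hc & Hw & E)]; [now left |].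
      right; exists (comb c a b), w; repeat split; try tauto; try lra.
      now apply hull_convex. }
    intros x y u [-> | (a & t & Ha & Ht & ->)] [-> | (b & s & Hb & Hs & ->)] Hu.
    + left; destruct p; unfold comb; simpl; f_equal; ring.
    + pose proof (HJ b b 0 s u) as H; rewrite <- H0 in H; apply H; auto; lra.
    + pose proof (HJ a a t 0 u) as H; rewrite <- H0 in H; apply H; auto; lra.
    + apply HJ; auto.
  - intros a [Ha | ->]; [right | now left].
    exists a, 1; repeat split; try lra; [now apply hull_base |].
    destruct p, a; unfold comb; simpl; f_equal; ring.
Qed.

(** Substituting q = (1-t)p + ta into p = (1-s)q + sb and solving for [p] gives a convex combination
    of two points [a], [b] of [hull A], with weights proportional to (1-s)t and s. Their sum s + t -
    st vanishes only for s = t = 0, which forces q = p. *)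
Lemma hull_antiexchange (A : pset) (p q : point) :
  ~ hull A p -> q <> p ->
  hull (fun a => A a \/ a = p) q -> ~ hull (fun a => A a \/ a = q) p.
Proof.
  intros Hp Hqp Hq Hp'.
  destruct (hull_insert _ _ _ Hq) as [E | (a & t & Ha & Ht & Eq)]; [easy |].
  destruct (hull_insert _ _ _ Hp') as [E | (b & s & Hb & Hs & Ep)]; [now apply Hqp |].
  destruct (Req_dec (s + t - s * t) 0) as [H0 | H0].
  - assert (Hs0 : s = 0) by nra.
    apply Hqp; rewrite Ep, Hs0; destruct q; unfold comb; simpl; f_equal; ring.
  - apply Hp.
    assert (Hpos : 0 < s + t - s * t) by nra.
    replace p with (comb (s / (s + t - s * t)) a b).
    + apply hull_convex; auto; split.
      * apply Rmult_le_reg_r with (s + t - s * t); [lra |].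
        replace (s / (s + t - s * t) * (s + t - s * t)) with s by (field; lra); lra.
      * apply Rmult_le_reg_r with (s + t - s * t); [lra |].
        replace (s / (s + t - s * t) * (s + t - s * t)) with s by (field; lra); nra.
    + destruct p as [p1 p2], q as [q1 q2], a as [a1 a2], b as [b1 b2].
      unfold comb in *; simpl in *.
      injection Eq as Eq1 Eq2; injection Ep as Ep1 Ep2; f_equal.
      * apply Rmult_eq_reg_l with (s + t - s * t); [| exact H0].
        replace ((s + t - s * t) * ((1 - s / (s + t - s * t)) * a1 + s / (s + t - s * t) * b1))
          with ((1 - s) * t * a1 + s * b1) by (field; exact H0).
        rewrite Eq1 in Ep1; lra.
      * apply Rmult_eq_reg_l with (s + t - s * t); [| exact H0].
        replace ((s + t - s * t) * ((1 - s / (s + t - s * t)) * a2 + s / (s + t - s * t) * b2))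
          with ((1 - s) * t * a2 + s * b2) by (field; exact H0).
        rewrite Eq2 in Ep2; lra.
Qed.

(** * Helly reduction: from families of convex sets to hollow sets *)

(* The points of [P] are in convex position and [hull P] contains no other point of [S]. *)
Definition hollow (S : pset) (P : list point) : Prop :=
  forall q, S q -> ~ hull (del P q) q.

Definition coreless (S : pset) (P : list point) : Prop :=
  forall r, S r -> exists p, In p P /\ ~ hull (del P p) r.

Lemma remove_mid (l1 l2 L : list point) (p a : point) :
  L = l1 ++ p :: l2 -> In a L -> a <> p -> In a (l1 ++ l2).
Proof.
  intros -> Ha Hap; apply in_app_iff in Ha; apply in_app_iff.
  destruct Ha as [Ha | [Ha | Ha]]; auto; congruence.
Qed.

(** The outer induction is on the size of [L]; the inner one, in [Hmain], is on the size of a list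
    [A] of the points whose removal from [P] takes [q] out of the hull. Replacing such a point [p]
    by [q] either gives a coreless set whose hull has lost [p], so [L] shrinks, or leaves a point
    [r] common to all the new hulls, for which [A] shrinks. *)
Lemma coreless_hollow (S : pset) (n : nat) : forall (P L : list point),
  NoDup P -> (forall p, In p P -> S p) -> coreless S P ->
  (forall q, S q -> hull (fun a => In a P) q -> In q L) -> (length L <= n)%nat ->
  exists P', length P' = length P /\ NoDup P' /\ (forall p, In p P' -> S p) /\ hollow S P'.
Proof.
  induction n as [| n IHn]; intros P L HND HPS Hcore HL Hlen.
  { destruct L; [| simpl in Hlen; lia].
    exists P; repeat split; auto; intros q Hq H.
    apply (HL q Hq); revert H; apply hull_mono; intros a [Ha _]; exact Ha. }
  destruct (classic (hollow S P)) as [HE | HE]; [exists P; auto |].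
  (* A point of [P] in the hull of the others would lie in all the hulls, against corelessness. *)
  assert (Hext : forall p, In p P -> ~ hull (del P p) p).
  { intros p Hp H; destruct (Hcore p (HPS p Hp)) as (p' & Hp' & Hn).
    destruct (classic (p = p')) as [<- | Hne]; [auto |].
    apply Hn, hull_base; split; auto. }
  assert (Hanti : forall p q, In p P -> ~ In q P -> hull (fun a => In a P) q ->
            ~ hull (fun a => del P p a \/ a = q) p).
  { intros p q Hp Hq Hhq; apply hull_antiexchange; auto; [congruence |].
    revert Hhq; apply hull_mono; intros a Ha.
    destruct (classic (a = p)); [now right | left; split; auto]. }
  assert (Hmain : forall m q A, S q -> ~ In q P -> hull (fun a => In a P) q ->
    (forall p, In p P -> ~ hull (del P p) q -> In p A) -> (length A <= m)%nat ->
    exists P', length P' = length P /\ NoDup P' /\ (forall p, In p P' -> S p) /\ hollow S P').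
  { induction m as [| m IHm]; intros q A Hq HqP Hhq HA Hm.
    { destruct (Hcore q Hq) as (p & Hp & Hn); pose proof (HA p Hp Hn) as H.
      destruct A; [easy | simpl in Hm; lia]. }
    destruct (Hcore q Hq) as (p & Hp & Hn).
    destruct (in_split _ _ Hp) as (l1 & l2 & EP).
    set (P' := q :: l1 ++ l2).
    assert (HP' : forall a, In a P' -> a = q \/ (In a P /\ a <> p)).
    { intros a [<- | Ha]; [now left | right; split].
      - rewrite EP; apply in_app_iff in Ha; apply in_app_iff; simpl; tauto.
      - intros ->; rewrite EP in HND; now apply NoDup_remove_2 in HND. }
    assert (HP'2 : forall a, In a P -> a <> p -> In a P')
      by (intros a Ha Hap; right; eapply remove_mid; eauto).
    assert (Hp' : ~ hull (fun a => In a P') p).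
    { intros H; apply (Hanti p q Hp HqP Hhq); revert H; apply hull_mono.
      intros a Ha; destruct (HP' a Ha) as [-> | [H1 H2]]; [now right | left; split; auto]. }
    assert (HPP : forall r, hull (fun a => In a P') r -> hull (fun a => In a P) r).
    { intros r; apply hull_le; intros a Ha.
      destruct (HP' a Ha) as [-> | [H1 _]]; [exact Hhq | now apply hull_base]. }
    destruct (classic (coreless S P')) as [HC | HC].
    - assert (HpL : In p L) by (apply HL; [auto | now apply hull_base]).
      destruct (in_split _ _ HpL) as (k1 & k2 & EL).
      destruct (IHn P' (k1 ++ k2)) as (P2 & HP2 & HP2').
      + constructor.
        * intros H; apply HqP; rewrite EP; apply in_app_iff in H; apply in_app_iff; simpl; tauto.
        * rewrite EP in HND; now apply NoDup_remove_1 in HND.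
      + intros a Ha; destruct (HP' a Ha) as [-> | [H1 _]]; auto.
      + exact HC.
      + intros r Hr Hhr; apply (remove_mid k1 k2 L p r EL); [now apply HL; auto |].
        intros ->; contradiction.
      + rewrite EL, length_app in Hlen; simpl in Hlen; rewrite length_app; lia.
      + exists P2; split; [| exact HP2'].
        rewrite HP2, EP; unfold P'; simpl; rewrite !length_app; simpl; lia.
    - apply not_all_ex_not in HC; destruct HC as [r HC].
      apply imply_to_and in HC; destruct HC as [Hr HC].
      assert (Hcr : forall a, In a P' -> hull (del P' a) r).
      { intros a Ha; apply NNPP; intros H; apply HC; now exists a. }
      assert (HqP' : In q P') by now left.
      assert (Hrq := Hcr q HqP').
      assert (HrP' : hull (fun a => In a P') r)
        by (revert Hrq; apply hull_mono; intros a [Ha _]; exact Ha).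
      (* [P'] without [q] is [P] without [p], so [p] no longer counts against [r]. *)
      assert (Hrp : hull (del P p) r).
      { revert Hrq; apply hull_mono; intros a [Ha Haq].
        destruct (HP' a Ha) as [-> | H]; [easy | exact H]. }
      assert (HpA : In p A) by auto.
      destruct (in_split _ _ HpA) as (k1 & k2 & EA).
      apply (IHm r (k1 ++ k2)).
      + exact Hr.
      + intros HrP; destruct (classic (r = p)) as [-> | Hne]; [contradiction |].
        apply (Hanti r q HrP HqP Hhq).
        generalize (Hcr r (HP'2 r HrP Hne)); apply hull_mono; intros a [Ha Har].
        destruct (HP' a Ha) as [-> | [H _]]; [now right | left; split; auto].
      + now apply HPP.
      (* If the hull of [P] minus [a] contains [q], it contains the hull of [P'] minus [a], and thus
         [r]. So every point counting against [r] already counted against [q]. *)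
      + intros a Ha Hnr.
        assert (Hap : a <> p) by (intros ->; contradiction).
        apply (remove_mid k1 k2 A p a EA); [| exact Hap].
        apply HA; auto; intros Hqa; apply Hnr.
        generalize (Hcr a (HP'2 a Ha Hap)); apply hull_le; intros b [Hb Hba].
        destruct (HP' b Hb) as [-> | [H _]]; [exact Hqa | apply hull_base; split; auto].
      + rewrite EA, length_app in Hm; simpl in Hm; rewrite length_app; lia. }
  apply not_all_ex_not in HE; destruct HE as [q HE].
  apply imply_to_and in HE; destruct HE as [Hq HE]; apply NNPP in HE.
  apply (Hmain (length P) q P); auto.
  - intros HqP; exact (Hext q HqP HE).
  - revert HE; apply hull_mono; intros a [Ha _]; exact Ha.
Qed.

Lemma minimal_subfamily (S : pset) (n : nat) : forall F : list pset,
  (length F <= n)%nat -> ~ meets S F ->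
  exists G, incl G F /\ ~ meets S G /\
    forall l1 C l2, G = l1 ++ C :: l2 -> meets S (l1 ++ l2).
Proof.
  induction n as [| n IHn]; intros F HF Hn.
  - exists F; repeat split; auto; [apply incl_refl |].
    intros l1 C l2 ->; rewrite length_app in HF; simpl in HF; lia.
  - destruct (classic (forall l1 C l2, F = l1 ++ C :: l2 -> meets S (l1 ++ l2))) as [H | H].
    + exists F; repeat split; auto; apply incl_refl.
    + apply not_all_ex_not in H; destruct H as [l1 H].
      apply not_all_ex_not in H; destruct H as [C H].
      apply not_all_ex_not in H; destruct H as [l2 H].
      apply imply_to_and in H; destruct H as [-> H].
      destruct (IHn (l1 ++ l2)) as (G & HG & HG'); auto.
      { rewrite length_app in *; simpl in HF; lia. }
      exists G; split; [| exact HG'].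
      intros D HD; apply HG in HD; apply in_app_iff in HD; apply in_app_iff; simpl; tauto.
Qed.

Lemma NoDup_split {A : Type} (l : list A) :
  (forall l1 x l2, l = l1 ++ x :: l2 -> ~ In x (l1 ++ l2)) -> NoDup l.
Proof.
  induction l as [| a l IH]; intros H; constructor.
  - exact (H [] a l eq_refl).
  - apply IH; intros l1 x l2 E Hx.
    apply (H (a :: l1) x l2); [now rewrite E | now right].
Qed.

(* In a minimal family missing [S], each member is avoided by a point of [S] common to all the
   others; these points form a coreless set with as many points as the family has members. *)
Lemma minimal_family_points (S : pset) (G : list pset) :
  (forall C, In C G -> convex C) -> ~ meets S G ->
  (forall l1 C l2, G = l1 ++ C :: l2 -> meets S (l1 ++ l2)) ->
  exists P, length P = length G /\ NoDup P /\ (forall p, In p P -> S p) /\ coreless S P.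
Proof.
  intros Hconv Hn Hmin.
  set (R := fun (C : pset) p => S p /\ ~ C p /\ forall D, In D G -> D <> C -> D p).
  assert (Hsplit : forall l1 C l2, G = l1 ++ C :: l2 ->
            exists p, S p /\ ~ C p /\ forall D, In D (l1 ++ l2) -> D p).
  { intros l1 C l2 E; destruct (Hmin l1 C l2 E) as (p & Hp & HD).
    exists p; repeat split; auto; intros HC; apply Hn; exists p; split; auto.
    intros D HDG; rewrite E in HDG; apply in_app_iff in HDG.
    destruct HDG as [H | [<- | H]]; auto; apply HD, in_app_iff; auto. }
  (* A second copy of [C] would be among the other members, whose chosen common point avoids [C]. *)
  assert (HND : NoDup G).
  { apply NoDup_split; intros l1 C l2 E HC.
    destruct (Hsplit l1 C l2 E) as (p & _ & H & HD); exact (H (HD C HC)). }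
  (* The point (0, 0) only witnesses that [point] is inhabited; on members of [G] the choice
     satisfies [R]. *)
  set (f := fun C => epsilon (inhabits (0, 0)) (R C)).
  assert (Hf : forall C, In C G -> R C (f C)).
  { intros C HC; apply epsilon_spec.
    destruct (in_split _ _ HC) as (l1 & l2 & E).
    destruct (Hsplit l1 C l2 E) as (p & H1 & H2 & H3); exists p; repeat split; auto.
    intros D HD HDC; apply H3; rewrite E in HD; apply in_app_iff in HD; apply in_app_iff.
    destruct HD as [H | [H | H]]; auto; congruence. }
  exists (map f G); split; [apply length_map |]; split; [| split].
  - apply NoDup_map_NoDup_ForallPairs; [| exact HND].
    intros C D HC HD E; apply NNPP; intros Hne.
    destruct (Hf C HC) as (_ & HfC & _); apply HfC; rewrite E.
    apply (Hf D HD); auto.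
  - intros p Hp; apply in_map_iff in Hp; destruct Hp as (C & <- & HC); exact (proj1 (Hf C HC)).
  (* All chosen points other than [f C] lie in [C], and so does their hull by convexity. A point of
     [S] in all these hulls would be common to the whole of [G]. *)
  - intros r Hr; apply NNPP; intros Hcon; apply Hn; exists r; split; auto.
    intros C HC; apply NNPP; intros HrC; apply Hcon.
    exists (f C); split; [now apply in_map |].
    intros H; apply HrC, H; [now apply Hconv |].
    intros a [Ha Hne]; apply in_map_iff in Ha; destruct Ha as (D & <- & HD).
    refine (proj2 (proj2 (Hf D HD)) C HC _); intros E; apply Hne; now subst D.
Qed.

(** A counterexample [F] contains a minimal subfamily [G] missing [S], and [G] has as many members
    as some hollow set has points. So [G] has at most [h] members and must meet [S]. Local
    finiteness supplies the list on which the reduction to hollow sets terminates. *)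
Lemma helly_property_of_hollow_bound (S : pset) (h : nat) :
  (forall P, (forall p, In p P -> S p) ->
     exists L, forall q, S q -> hull (fun a => In a P) q -> In q L) ->
  (forall P, NoDup P -> (forall p, In p P -> S p) -> hollow S P -> (length P <= h)%nat) ->
  helly_property S h.
Proof.
  intros Hfin Hbound F Hconv HF; apply NNPP; intros Hn.
  destruct (minimal_subfamily S (length F) F (le_n _) Hn) as (G & HGF & HGn & HGmin).
  destruct (minimal_family_points S G) as (P & HPl & HPN & HPS & HPc); auto.
  destruct (Hfin P HPS) as (L & HL).
  destruct (coreless_hollow S (length L) P L HPN HPS HPc HL (le_n _))
    as (P' & Hl & HN & HS & HE).
  apply HGn, HF; [exact HGF |].
  rewrite <- HPl, <- Hl; now apply Hbound.
Qed.

Lemma helly_number_le (S : pset) (h : nat) :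
  helly_property S h -> exists h', is_helly_number S h' /\ (h' <= h)%nat.
Proof.
  induction h as [h IH] using (well_founded_induction lt_wf); intros Hh.
  destruct (classic (exists h', (h' < h)%nat /\ helly_property S h')) as [(h' & Hlt & H') | Hno].
  - destruct (IH h' Hlt H') as (k & Hk & Hle); exists k; split; [exact Hk | lia].
  - exists h; split; [split; [exact Hh |] | lia].
    intros h' H'; apply Nat.nlt_ge; intros Hlt; apply Hno; eauto.
Qed.

(** * Hollow sets in logarithmic coordinates and their symmetries *)

(** Exponents are integers rather than naturals because [flip] does not preserve the nonnegative
    quadrant. *)
Definition tri (alpha : R) (p1 p2 p3 q : Z * Z) : Prop :=
  exists l1 l2 l3, 0 <= l1 /\ 0 <= l2 /\ 0 <= l3 /\ l1 + l2 + l3 = 1 /\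
    powerRZ alpha (fst q) = l1 * powerRZ alpha (fst p1) + l2 * powerRZ alpha (fst p2)
                            + l3 * powerRZ alpha (fst p3) /\
    powerRZ alpha (snd q) = l1 * powerRZ alpha (snd p1) + l2 * powerRZ alpha (snd p2)
                            + l3 * powerRZ alpha (snd p3).

(** By Carathéodory, triangles suffice in the plane. Vertices may coincide, so segments are
    included. *)
Definition hollow3 (alpha : R) (P : list (Z * Z)) : Prop :=
  forall q p1 p2 p3, In p1 P -> In p2 P -> In p3 P ->
    q <> p1 -> q <> p2 -> q <> p3 -> ~ tri alpha p1 p2 p3 q.

Definition swap (p : Z * Z) : Z * Z := (snd p, fst p).

(* The projective map (x, y) |-> (1 / x, y / x), which preserves convexity in the open quadrant. *)
Definition flip (p : Z * Z) : Z * Z := (- fst p, snd p - fst p)%Z.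

(** The diagonal neighbours belong here because the homogeneous coordinates [0 : m : n] are treated
    symmetrically: [swap] and [flip] permute the three directions. *)
Definition adj (p q : Z * Z) : Prop :=
  ((fst p = fst q /\ (snd p - snd q = 1 \/ snd p - snd q = -1)) \/
   (snd p = snd q /\ (fst p - fst q = 1 \/ fst p - fst q = -1)) \/
   (fst p - fst q = snd p - snd q /\ (fst p - fst q = 1 \/ fst p - fst q = -1)))%Z.

(* In homogeneous coordinates [1 : x : y] with logarithms [0, m, n], a pair of points off the common
   lines through the coordinate points is classified by which of the three coordinates of the
   difference of logarithms is the middle one. *)
Definition mid0 (p q : Z * Z) : Prop :=
  ((fst p < fst q /\ snd q < snd p) \/ (fst q < fst p /\ snd p < snd q))%Z.
Definition mid1 (p q : Z * Z) : Prop :=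
  ((0 < fst p - fst q < snd p - snd q) \/ (snd p - snd q < fst p - fst q < 0))%Z.
Definition mid2 (p q : Z * Z) : Prop :=
  ((0 < snd p - snd q < fst p - fst q) \/ (fst p - fst q < snd p - snd q < 0))%Z.

Lemma swap_swap (p : Z * Z) : swap (swap p) = p.
Proof. now destruct p. Qed.

Lemma flip_flip (p : Z * Z) : flip (flip p) = p.
Proof. destruct p; unfold flip; simpl; f_equal; lia. Qed.

Inductive coord := C0 | C1 | C2.

Definition mid (c : coord) : Z * Z -> Z * Z -> Prop :=
  match c with C0 => mid0 | C1 => mid1 | C2 => mid2 end.

Lemma mid_sym (c : coord) (p q : Z * Z) : mid c p q -> mid c q p.
Proof. destruct c; simpl; unfold mid0, mid1, mid2; lia. Qed.

Lemma adj_sym (p q : Z * Z) : adj p q -> adj q p.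
Proof. unfold adj; lia. Qed.

Lemma mid_neq (c : coord) (p q : Z * Z) : mid c p q -> p <> q.
Proof. intros H ->; destruct c; simpl in H; unfold mid0, mid1, mid2 in H; lia. Qed.

Section Alpha.
Context (alpha : R) (Halpha : 1 < alpha).

Lemma pw_pos (m : Z) : 0 < powerRZ alpha m.
Proof. apply powerRZ_lt; lra. Qed.

Lemma pw_add (m n : Z) : powerRZ alpha (m + n) = powerRZ alpha m * powerRZ alpha n.
Proof. apply powerRZ_add; lra. Qed.

Lemma pw_succ (m : Z) : powerRZ alpha (m + 1) = alpha * powerRZ alpha m.
Proof. rewrite pw_add, powerRZ_1; ring. Qed.

Lemma pw_pred (m : Z) : alpha * powerRZ alpha (m - 1) = powerRZ alpha m.
Proof. rewrite <- pw_succ; f_equal; lia. Qed.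

Lemma pw_lt (m n : Z) : (m < n)%Z -> powerRZ alpha m < powerRZ alpha n.
Proof.
  intros H; replace n with (m + Z.of_nat (Z.to_nat (n - m)))%Z by lia.
  rewrite pw_add, <- pow_powerRZ.
  pose proof (Rlt_pow_R1 alpha (Z.to_nat (n - m)) Halpha ltac:(lia)).
  pose proof (pw_pos m); nra.
Qed.

Lemma pw_le (m n : Z) : (m <= n)%Z -> powerRZ alpha m <= powerRZ alpha n.
Proof.
  intros H; destruct (Z.eq_dec m n) as [-> | Hne]; [lra |].
  apply Rlt_le, pw_lt; lia.
Qed.

Lemma hollow3_swap (P : list (Z * Z)) : hollow3 alpha P -> hollow3 alpha (map swap P).
Proof.
  intros HP q p1 p2 p3 H1 H2 H3 N1 N2 N3 (l1 & l2 & l3 & L1 & L2 & L3 & Hs & Hx & Hy).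
  apply in_map_iff in H1, H2, H3.
  destruct H1 as (a1 & <- & H1), H2 as (a2 & <- & H2), H3 as (a3 & <- & H3).
  apply (HP (swap q) a1 a2 a3); auto; try (intros E; rewrite <- E, swap_swap in *; now auto).
  exists l1, l2, l3; repeat split; auto.
Qed.

Lemma hollow3_flip (P : list (Z * Z)) : hollow3 alpha P -> hollow3 alpha (map flip P).
Proof.
  intros HP q p1 p2 p3 H1 H2 H3 N1 N2 N3 (l1 & l2 & l3 & L1 & L2 & L3 & Hs & Hx & Hy).
  apply in_map_iff in H1, H2, H3.
  destruct H1 as (a1 & <- & H1), H2 as (a2 & <- & H2), H3 as (a3 & <- & H3).
  apply (HP (flip q) a1 a2 a3); auto; try (intros E; rewrite <- E, flip_flip in *; now auto).
  destruct q as [m n], a1 as [m1 n1], a2 as [m2 n2], a3 as [m3 n3].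
  unfold flip in Hx, Hy; simpl in Hx, Hy; unfold tri, flip; simpl.
  (* Projective change of weights: each is multiplied by the abscissa of its vertex and divided by
     that of [q]. The equation for the abscissa and the condition that the weights sum to 1 change
     places. *)
  exists (l1 * powerRZ alpha (- m1) * powerRZ alpha (- m)),
         (l2 * powerRZ alpha (- m2) * powerRZ alpha (- m)),
         (l3 * powerRZ alpha (- m3) * powerRZ alpha (- m)).
  pose proof (pw_pos (- m)); pose proof (pw_pos (- m1));
    pose proof (pw_pos (- m2)); pose proof (pw_pos (- m3)).
  assert (Hinv : forall k, powerRZ alpha (- k) * powerRZ alpha k = 1)
    by (intros k; rewrite <- pw_add, Z.add_opp_diag_l; reflexivity).
  unfold Zminus in *; rewrite ?pw_add in *.
  repeat split; try (repeat apply Rmult_le_pos; lra).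
  - rewrite <- (Hinv m), Hx; ring.
  - transitivity (powerRZ alpha (- m) * (l1 + l2 + l3)); [rewrite Hs; ring |].
    transitivity (powerRZ alpha (- m) * (l1 * (powerRZ alpha (- m1) * powerRZ alpha m1)
      + l2 * (powerRZ alpha (- m2) * powerRZ alpha m2)
      + l3 * (powerRZ alpha (- m3) * powerRZ alpha m3))); [rewrite !Hinv |]; ring.
  - rewrite Hy; ring.
Qed.

(* The segment [uz] crosses the column of [v] at height [H / D]. *)
Lemma hollow3_column (P : list (Z * Z)) (u v z : Z * Z) (n : Z) :
  hollow3 alpha P -> In u P -> In v P -> In z P ->
  (fst u < fst v < fst z)%Z ->
  let D := powerRZ alpha (fst z) - powerRZ alpha (fst u) in
  let H := (powerRZ alpha (fst z) - powerRZ alpha (fst v)) * powerRZ alpha (snd u)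
           + (powerRZ alpha (fst v) - powerRZ alpha (fst u)) * powerRZ alpha (snd z) in
  ((snd v < n)%Z /\ powerRZ alpha n * D <= H) \/
  ((n < snd v)%Z /\ H <= powerRZ alpha n * D) -> False.
Proof.
  intros HP Hu Hv Hz Hm D H Hn.
  assert (Huv := pw_lt (fst u) (fst v) ltac:(lia)).
  assert (Hvz := pw_lt (fst v) (fst z) ltac:(lia)).
  assert (HD : 0 < D) by (unfold D; lra).
  apply (HP (fst v, n) v u z Hv Hu Hz).
  { destruct v as [v1 v2]; intros E; injection E as ->; simpl in Hn; lia. }
  { intros E; rewrite <- E in Hm; simpl in Hm; lia. }
  { intros E; rewrite <- E in Hm; simpl in Hm; lia. }
  (* [E] is [D] times the signed height of the segment [uz] above [v]; its sign separates the two
     cases. *)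
  set (E := H - powerRZ alpha (snd v) * D).
  assert (HE : E <> 0 /\ 0 <= (H - powerRZ alpha n * D) / E
               /\ 0 <= (powerRZ alpha n - powerRZ alpha (snd v)) / E).
  { destruct Hn as [[Hn HH] | [Hn HH]]; apply pw_lt in Hn.
    - assert (0 < E) by (unfold E; nra).
      repeat split; [lra | |]; apply Rmult_le_pos; try lra;
        apply Rlt_le, Rinv_0_lt_compat; lra.
    - assert (0 < - E) by (unfold E; nra).
      assert (Hopp : forall x, x / E = - x * / - E) by (intros x; field; lra).
      repeat split; [lra | |]; rewrite Hopp; apply Rmult_le_pos; try lra;
        apply Rlt_le, Rinv_0_lt_compat; lra. }
  destruct HE as (HE & HE1 & HE2).
  set (s := (powerRZ alpha n - powerRZ alpha (snd v)) / E) in *.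
  (* Barycentric coordinates: the target lies between [v] and the crossing point on [uz]. The share
     [s * D] of the crossing point is split between [u] and [z] according to abscissae. *)
  exists ((H - powerRZ alpha n * D) / E),
         (s * (powerRZ alpha (fst z) - powerRZ alpha (fst v))),
         (s * (powerRZ alpha (fst v) - powerRZ alpha (fst u))).
  repeat split; try assumption; try (apply Rmult_le_pos; lra); simpl; unfold s.
  - apply Rmult_eq_reg_l with E; [| exact HE]; field_simplify; [| exact HE].
    unfold E, D; ring.
  - apply Rmult_eq_reg_l with E; [| exact HE]; field_simplify; [| exact HE].
    unfold E, D; ring.
  - apply Rmult_eq_reg_l with E; [| exact HE]; field_simplify; [| exact HE].
    unfold E, H, D; ring.
Qed.

Lemma hollow3_row (P : list (Z * Z)) (u v z : Z * Z) (m : Z) :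
  hollow3 alpha P -> In u P -> In v P -> In z P ->
  (snd u < snd v < snd z)%Z ->
  let D := powerRZ alpha (snd z) - powerRZ alpha (snd u) in
  let H := (powerRZ alpha (snd z) - powerRZ alpha (snd v)) * powerRZ alpha (fst u)
           + (powerRZ alpha (snd v) - powerRZ alpha (snd u)) * powerRZ alpha (fst z) in
  ((fst v < m)%Z /\ powerRZ alpha m * D <= H) \/
  ((m < fst v)%Z /\ H <= powerRZ alpha m * D) -> False.
Proof.
  intros HP Hu Hv Hz.
  exact (hollow3_column (map swap P) (swap u) (swap v) (swap z) m (hollow3_swap P HP)
           (in_map swap P u Hu) (in_map swap P v Hv) (in_map swap P z Hz)).
Qed.

(** Otherwise the lattice point just above the lower one lies strictly inside the segment, which is
    a triangle with a repeated vertex. *)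
Lemma same_column (P : list (Z * Z)) (p q : Z * Z) :
  hollow3 alpha P -> In p P -> In q P -> fst p = fst q -> (Z.abs (snd p - snd q) <= 1)%Z.
Proof.
  intros HP.
  enough (Hlt : forall p q, In p P -> In q P -> fst p = fst q -> ~ (snd p + 1 < snd q)%Z).
  { intros Hp Hq E; pose proof (Hlt p q Hp Hq E); pose proof (Hlt q p Hq Hp (eq_sym E)); lia. }
  clear p q; intros [m n] [m' n'] Hp Hq E Hlt; simpl in E, Hlt; subst m'.
  apply (HP (m, n + 1)%Z (m, n) (m, n') (m, n') Hp Hq Hq); try (intros E; injection E; lia).
  assert (H1 := pw_lt n (n + 1) ltac:(lia)).
  assert (H2 := pw_lt (n + 1) n' ltac:(lia)).
  set (a := powerRZ alpha n) in *; set (b := powerRZ alpha (n + 1)) in *;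
    set (c := powerRZ alpha n') in *.
  exists ((c - b) / (c - a)), ((b - a) / (c - a)), 0.
  repeat split; try lra; try (apply Rmult_le_pos; [lra | apply Rlt_le, Rinv_0_lt_compat; lra]);
    simpl; fold a b c; field; lra.
Qed.

Lemma same_row (P : list (Z * Z)) (p q : Z * Z) :
  hollow3 alpha P -> In p P -> In q P -> snd p = snd q -> (Z.abs (fst p - fst q) <= 1)%Z.
Proof.
  intros HP Hp Hq.
  exact (same_column (map swap P) (swap p) (swap q) (hollow3_swap P HP)
           (in_map swap P p Hp) (in_map swap P q Hq)).
Qed.

(** [flip] turns diagonals into rows. *)
Lemma same_diagonal (P : list (Z * Z)) (p q : Z * Z) :
  hollow3 alpha P -> In p P -> In q P -> (fst p - fst q = snd p - snd q)%Z ->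
  (Z.abs (fst p - fst q) <= 1)%Z.
Proof.
  intros HP Hp Hq E.
  pose proof (same_row (map flip P) (flip p) (flip q) (hollow3_flip P HP)
           (in_map flip P p Hp) (in_map flip P q Hq)) as H.
  unfold flip in H; simpl in H; lia.
Qed.

(** * Classification of pairs of points and reduction to a single class *)

Lemma pair_cases (P : list (Z * Z)) (p q : Z * Z) :
  hollow3 alpha P -> In p P -> In q P -> p <> q ->
  adj p q \/ mid0 p q \/ mid1 p q \/ mid2 p q.
Proof.
  intros HP Hp Hq Hne.
  pose proof (same_column P p q HP Hp Hq) as H1.
  pose proof (same_row P p q HP Hp Hq) as H2.
  pose proof (same_diagonal P p q HP Hp Hq) as H3.
  assert (Hne' : ~ (fst p = fst q /\ snd p = snd q)).
  { intros [E1 E2]; apply Hne; destruct p, q; simpl in *; congruence. }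
  unfold adj, mid0, mid1, mid2; lia.
Qed.

(* Whatever the signs, the segment [uz] meets one of the axis-parallel rays issuing from [v] at or
   beyond the lattice neighbour of [v], which then lies in the triangle [uvz]. *)
Lemma mid0_mid1 (P : list (Z * Z)) (v u z : Z * Z) :
  hollow3 alpha P -> In v P -> In u P -> In z P -> mid0 v u -> mid1 v z -> False.
Proof.
  intros HP Hv Hu Hz [[H0 H0'] | [H0 H0']] [H1 | H1].
  - apply (hollow3_column P z v u (snd v - 1) HP Hz Hv Hu ltac:(lia)).
    right; split; [lia |].
    pose proof (pw_lt (fst z) (fst v) ltac:(lia)); pose proof (pw_lt (fst v) (fst u) ltac:(lia)).
    pose proof (pw_le (snd z) (snd v - 1) ltac:(lia)).
    pose proof (pw_le (snd u) (snd v - 1) ltac:(lia)); nra.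
  - apply (hollow3_row P u v z (fst v + 1) HP Hu Hv Hz ltac:(lia)).
    left; split; [lia |].
    pose proof (pw_lt (snd u) (snd v) ltac:(lia)); pose proof (pw_lt (snd v) (snd z) ltac:(lia)).
    pose proof (pw_le (fst v + 1) (fst z) ltac:(lia)).
    pose proof (pw_le (fst v + 1) (fst u) ltac:(lia)); nra.
  - apply (hollow3_row P z v u (fst v - 1) HP Hz Hv Hu ltac:(lia)).
    right; split; [lia |].
    pose proof (pw_lt (snd z) (snd v) ltac:(lia)); pose proof (pw_lt (snd v) (snd u) ltac:(lia)).
    pose proof (pw_le (fst z) (fst v - 1) ltac:(lia)).
    pose proof (pw_le (fst u) (fst v - 1) ltac:(lia)); nra.
  - apply (hollow3_column P u v z (snd v + 1) HP Hu Hv Hz ltac:(lia)).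
    left; split; [lia |].
    pose proof (pw_lt (fst u) (fst v) ltac:(lia)); pose proof (pw_lt (fst v) (fst z) ltac:(lia)).
    pose proof (pw_le (snd v + 1) (snd z) ltac:(lia)).
    pose proof (pw_le (snd v + 1) (snd u) ltac:(lia)); nra.
Qed.

(** [swap] fixes [mid0] and exchanges [mid1] with [mid2]. *)
Lemma mid0_mid2 (P : list (Z * Z)) (v u z : Z * Z) :
  hollow3 alpha P -> In v P -> In u P -> In z P -> mid0 v u -> mid2 v z -> False.
Proof.
  intros HP Hv Hu Hz H0 H2.
  apply (mid0_mid1 (map swap P) (swap v) (swap u) (swap z) (hollow3_swap P HP));
    try (now apply in_map); unfold mid0, mid1, mid2, swap in *; simpl; lia.
Qed.

(** [flip] fixes [mid2] and exchanges [mid0] with [mid1]. *)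
Lemma mid1_mid2 (P : list (Z * Z)) (v u z : Z * Z) :
  hollow3 alpha P -> In v P -> In u P -> In z P -> mid1 v u -> mid2 v z -> False.
Proof.
  intros HP Hv Hu Hz H1 H2.
  apply (mid0_mid2 (map flip P) (flip v) (flip u) (flip z) (hollow3_flip P HP));
    try (now apply in_map); unfold mid0, mid1, mid2, flip in *; simpl; lia.
Qed.

(* The fourth vertex of a parallelogram is unique, so [c] and [d] have at most two common
   neighbours. *)
Lemma adj_parallelogram (a b c d : Z * Z) :
  adj a c -> adj a d -> adj b c -> adj b d -> a <> b ->
  mid0 c d \/ mid1 c d \/ mid2 c d ->
  (fst a + fst b = fst c + fst d /\ snd a + snd b = snd c + snd d)%Z.
Proof.
  intros H1 H2 H3 H4 Hne H5.
  assert (Hne' : ~ (fst a = fst b /\ snd a = snd b)).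
  { intros [E1 E2]; apply Hne; destruct a, b; simpl in *; congruence. }
  clear Hne; revert H3 H4 Hne'.
  unfold adj, mid0, mid1, mid2 in *.
  destruct H1 as [[? [?|?]] | [[? [?|?]] | [? [?|?]]]];
    destruct H2 as [[? [?|?]] | [[? [?|?]] | [? [?|?]]]]; try (exfalso; lia);
    clear H5; intros H3 H4 Hne';
    destruct H3 as [[? [?|?]] | [[? [?|?]] | [? [?|?]]]]; try lia;
    destruct H4 as [[? [?|?]] | [[? [?|?]] | [? [?|?]]]]; lia.
Qed.

Lemma adj_or_mid (P : list (Z * Z)) (p q : Z * Z) :
  hollow3 alpha P -> In p P -> In q P -> p <> q -> adj p q \/ exists c, mid c p q.
Proof.
  intros HP Hp Hq Hne.
  destruct (pair_cases P p q HP Hp Hq Hne) as [H | [H | [H | H]]]; [now left | right ..];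
    [exists C0 | exists C1 | exists C2]; exact H.
Qed.

Lemma mid_unique (P : list (Z * Z)) (v u z : Z * Z) (c d : coord) :
  hollow3 alpha P -> In v P -> In u P -> In z P -> mid c v u -> mid d v z -> c = d.
Proof.
  intros HP Hv Hu Hz Hc Hd; destruct c, d; try reflexivity; exfalso; simpl in Hc, Hd.
  - exact (mid0_mid1 P v u z HP Hv Hu Hz Hc Hd).
  - exact (mid0_mid2 P v u z HP Hv Hu Hz Hc Hd).
  - exact (mid0_mid1 P v z u HP Hv Hz Hu Hd Hc).
  - exact (mid1_mid2 P v u z HP Hv Hu Hz Hc Hd).
  - exact (mid0_mid2 P v z u HP Hv Hz Hu Hd Hc).
  - exact (mid1_mid2 P v z u HP Hv Hz Hu Hd Hc).
Qed.

(** Each point of [P] takes part in at most one class, so [a], [b] are crosswise adjacent to [a'],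
    [b'] and the four points form a parallelogram with diagonals [ab] and [a'b']. A fifth point
    would be adjacent to both ends of one diagonal and so coincide with a vertex. *)
Lemma two_mids (P : list (Z * Z)) (a b a' b' : Z * Z) (c d : coord) :
  hollow3 alpha P -> In a P -> In b P -> In a' P -> In b' P ->
  mid c a b -> mid d a' b' -> c <> d -> incl P [a; b; a'; b'].
Proof.
  intros HP Ha Hb Ha' Hb' Hc Hd Hcd e He.
  assert (Hadj : forall u u' x x', In u P -> In u' P -> In x P -> In x' P ->
            mid c u u' -> mid d x x' -> adj u x).
  { intros u u' x x' Hu Hu' Hx Hx' Hm Hm'.
    destruct (classic (u = x)) as [-> | Hne].
    { exfalso; apply Hcd; apply (mid_unique P x u' x'); auto. }
    destruct (adj_or_mid P u x HP Hu Hx Hne) as [H | [r Hr]]; [exact H | exfalso; apply Hcd].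
    transitivity r; [apply (mid_unique P u u' x) | apply (mid_unique P x u x')];
      auto using mid_sym. }
  assert (Hc' := mid_sym _ _ _ Hc); assert (Hd' := mid_sym _ _ _ Hd).
  assert (H1 : adj a a') by (apply (Hadj a b a' b'); auto).
  assert (H2 : adj a b') by (apply (Hadj a b b' a'); auto).
  assert (H3 : adj b a') by (apply (Hadj b a a' b'); auto).
  assert (H4 : adj b b') by (apply (Hadj b a b' a'); auto).
  assert (Hoff : forall r p q, mid r p q -> mid0 p q \/ mid1 p q \/ mid2 p q)
    by (intros [] p q; simpl; auto).
  apply NNPP; intros Hn; simpl in Hn.
  assert (Hea : e <> a) by (intros ->; tauto).
  assert (Heb : e <> b) by (intros ->; tauto).
  assert (Hea' : e <> a') by (intros ->; tauto).
  assert (Heb' : e <> b') by (intros ->; tauto).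
  (* If [e] is not adjacent to one of [a], [b], that pair has class [c]; then [e] behaves like [a]
     and is adjacent to [a'] and [b']. *)
  assert (Hcase : (adj e a /\ adj e b) \/ (adj e a' /\ adj e b')).
  { destruct (adj_or_mid P e a HP He Ha Hea) as [Ha1 | [r Hr]].
    - destruct (adj_or_mid P e b HP He Hb Heb) as [Hb1 | [r Hr]]; [now left | right].
      assert (r = c) by (apply (mid_unique P b e a); auto using mid_sym); subst r.
      split; [apply (Hadj e b a' b') | apply (Hadj e b b' a')]; auto.
    - right; assert (r = c) by (apply (mid_unique P a e b); auto using mid_sym); subst r.
      split; [apply (Hadj e a a' b') | apply (Hadj e a b' a')]; auto. }
  assert (HP1 := adj_parallelogram a b a' b' H1 H2 H3 H4 (mid_neq _ _ _ Hc) (Hoff _ _ _ Hd)).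
  destruct Hcase as [[K1 K2] | [K1 K2]].
  - assert (HP2 := adj_parallelogram a' e a b (adj_sym _ _ H1) (adj_sym _ _ H3) K1 K2
             (not_eq_sym Hea') (Hoff _ _ _ Hc)).
    apply Heb'; destruct e, b'; simpl in *; f_equal; lia.
  - assert (HP2 := adj_parallelogram a e a' b' H1 H2 K1 K2
             (not_eq_sym Hea) (Hoff _ _ _ Hd)).
    apply Heb; destruct e, b; simpl in *; f_equal; lia.
Qed.

(** With more than four points [two_mids] leaves room for only one class. [flip] carries [mid1] to
    [mid0], and [swap] followed by [flip] carries [mid2] to [mid0]. *)
Lemma normalize_mid (P : list (Z * Z)) :
  hollow3 alpha P -> NoDup P -> (4 < length P)%nat ->
  exists P', length P' = length P /\ NoDup P' /\ hollow3 alpha P' /\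
    forall p q, In p P' -> In q P' -> p <> q -> adj p q \/ mid0 p q.
Proof.
  intros HP HN HL.
  assert (Hall : forall a b c, In a P -> In b P -> mid c a b ->
            forall p q, In p P -> In q P -> p <> q -> adj p q \/ mid c p q).
  { intros a b c Ha Hb Hab p q Hp Hq Hne.
    destruct (adj_or_mid P p q HP Hp Hq Hne) as [H | [d Hd]]; [now left | right].
    assert (E : c = d); [| now subst].
    apply NNPP; intros Hcd.
    pose proof (NoDup_incl_length HN (two_mids P a b p q c d HP Ha Hb Hp Hq Hab Hd Hcd)) as H.
    simpl in H; lia. }
  assert (Hinj : forall f : Z * Z -> Z * Z, (forall p, f (f p) = p) ->
            forall l, NoDup l -> NoDup (map f l)).
  { intros f Hf l; apply NoDup_map_NoDup_ForallPairs; intros p q _ _ E.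
    rewrite <- (Hf p), <- (Hf q); now f_equal. }
  destruct (classic (exists a b, In a P /\ In b P /\ mid C1 a b)) as [(a & b & Ha & Hb & Hab) | N1].
  { exists (map flip P); split; [apply length_map |]; split; [apply Hinj; auto using flip_flip |].
    split; [now apply hollow3_flip |].
    intros p q Hp Hq Hne; apply in_map_iff in Hp, Hq.
    destruct Hp as (p' & <- & Hp), Hq as (q' & <- & Hq).
    destruct (Hall a b C1 Ha Hb Hab p' q' Hp Hq) as [H | H]; [congruence | |];
      simpl in H; unfold adj, mid0, mid1, flip in *; simpl; lia. }
  destruct (classic (exists a b, In a P /\ In b P /\ mid C2 a b)) as [(a & b & Ha & Hb & Hab) | N2].
  { exists (map flip (map swap P)); split; [now rewrite !length_map |].
    split; [repeat apply Hinj; auto using flip_flip, swap_swap |].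
    split; [now apply hollow3_flip, hollow3_swap |].
    intros p q Hp Hq Hne; apply in_map_iff in Hp, Hq.
    destruct Hp as (p' & <- & Hp), Hq as (q' & <- & Hq); apply in_map_iff in Hp, Hq.
    destruct Hp as (p & <- & Hp), Hq as (q & <- & Hq).
    destruct (Hall a b C2 Ha Hb Hab p q Hp Hq) as [H | H]; [congruence | |];
      simpl in H; unfold adj, mid0, mid2, flip, swap in *; simpl; lia. }
  exists P; repeat split; auto; intros p q Hp Hq Hne.
  destruct (adj_or_mid P p q HP Hp Hq Hne) as [H | [[] H]]; auto; exfalso; eauto 6.
Qed.

(** * Points at least [k] columns to the left of another point *)

(** The condition on [k] is alpha^(-k) <= 1 - 1/alpha with denominators cleared. *)
Lemma scale_gap (k m n : Z) :
  alpha <= (alpha - 1) * powerRZ alpha k -> (m + k <= n)%Z ->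
  alpha * powerRZ alpha m <= (alpha - 1) * powerRZ alpha n.
Proof.
  intros Hk Hmn; pose proof (pw_le _ _ Hmn) as H; rewrite pw_add in H.
  pose proof (pw_pos m); pose proof (pw_pos k); nra.
Qed.

(** Suppose [p] is two or more rows below [t]. Above [p] the segment [tz] gives [t] weight at least
    1/alpha, since the abscissa of [p] is at most 1 - 1/alpha times that of [z]. So the segment
    passes at or above the row just below [t], and the triangle contains a lattice point over
    [p]. *)
Lemma far_rows (P : list (Z * Z)) (t z p : Z * Z) (k : Z) :
  hollow3 alpha P -> (forall p q, In p P -> In q P -> p <> q -> adj p q \/ mid0 p q) ->
  In t P -> In z P -> In p P -> (0 < k)%Z -> alpha <= (alpha - 1) * powerRZ alpha k ->
  (fst p + k <= fst z)%Z -> (snd t <= snd p + 1)%Z.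
Proof.
  intros HP Hmid Ht Hz Hp Hk Hak Hpz.
  apply Z.nlt_ge; intros Hlt.
  (* Two rows apart excludes adjacency, so the pair is of class [mid0]. *)
  assert (Htp : (fst t < fst p)%Z).
  { destruct (Hmid t p Ht Hp) as [H | H]; [intros ->; lia | |]; unfold adj, mid0 in H; lia. }
  apply (hollow3_column P t p z (snd t - 1) HP Ht Hp Hz ltac:(lia)).
  left; split; [lia |].
  pose proof (scale_gap k _ _ Hak Hpz); pose proof (pw_pred (snd t)) as Et.
  pose proof (pw_pos (snd t - 1)); pose proof (pw_pos (fst t)); pose proof (pw_pos (snd z)).
  pose proof (pw_lt _ _ Htp).
  rewrite <- Et.
  set (y := powerRZ alpha (snd t - 1)) in *.
  assert (0 <= y * (alpha * powerRZ alpha (fst z) - alpha * powerRZ alpha (fst p)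
                    - (powerRZ alpha (fst z) - powerRZ alpha (fst t)))) by (apply Rmult_le_pos; lra).
  assert (0 <= (powerRZ alpha (fst p) - powerRZ alpha (fst t)) * powerRZ alpha (snd z))
    by (apply Rmult_le_pos; lra).
  lra.
Qed.

(** The segment [zt] crosses the row of [c] and [p] at or to the right of [p], which puts [p] in the
    triangle [zct]. *)
Lemma far_not_four (P : list (Z * Z)) (a t c p z : Z * Z) (k : Z) :
  hollow3 alpha P -> (forall p q, In p P -> In q P -> p <> q -> adj p q \/ mid0 p q) ->
  In a P -> In t P -> In c P -> In p P -> In z P ->
  (0 < k)%Z -> alpha <= (alpha - 1) * powerRZ alpha k ->
  (fst t + k <= fst z)%Z -> (fst p + k <= fst z)%Z -> (snd z <= snd t)%Z ->
  fst t = (fst a + 1)%Z -> snd a = snd t ->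
  fst p = (fst c + 1)%Z -> snd c = snd p -> snd t = (snd p + 1)%Z -> False.
Proof.
  intros HP Hmid Ha Ht Hc Hp Hz Hk Hak Htz Hpz Hzt E1 E2 E3 E4 E5.
  (* [z] is at least two columns to the right of [a] and of [c], hence in neither of their rows and
     strictly below both. *)
  pose proof (same_row P z a HP Hz Ha); pose proof (same_row P z c HP Hz Hc).
  apply (hollow3_row P z c t (fst p) HP Hz Hc Ht ltac:(lia)).
  left; split; [lia |].
  pose proof (scale_gap k _ _ Hak Hpz); pose proof (pw_succ (snd p)) as Et.
  assert (Hzc : (snd z < snd c)%Z) by lia.
  pose proof (pw_lt _ _ Hzc) as Hy.
  rewrite E5, Et; rewrite E4 in *.
  pose proof (pw_pos (snd z)); pose proof (pw_pos (fst p)); pose proof (pw_pos (fst t)).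
  set (y := powerRZ alpha (snd p)) in *.
  assert (0 <= y * ((alpha - 1) * powerRZ alpha (fst z) - alpha * powerRZ alpha (fst p)))
    by (apply Rmult_le_pos; lra).
  assert (0 <= (y - powerRZ alpha (snd z)) * powerRZ alpha (fst t)) by (apply Rmult_le_pos; lra).
  assert (0 <= powerRZ alpha (snd z) * powerRZ alpha (fst p)) by (apply Rmult_le_pos; lra).
  lra.
Qed.
End Alpha.

(** * Counting the points of a hollow set *)

Lemma exists_max (f : Z * Z -> Z) (P : list (Z * Z)) :
  P <> [] -> exists z, In z P /\ forall p, In p P -> (f p <= f z)%Z.
Proof.
  induction P as [| a P IH]; intros HP; [easy |].
  destruct (classic (P = [])) as [-> | HP'].
  - exists a; split; [now left |]; intros p [<- | []]; lia.
  - destruct (IH HP') as (z & Hz & Hmax).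
    destruct (Z.le_gt_cases (f a) (f z)) as [H | H].
    + exists z; split; [now right |]; intros p [<- | Hp]; auto.
    + exists a; split; [now left |]; intros p [<- | Hp]; [lia |].
      specialize (Hmax p Hp); lia.
Qed.

(** Points of one column are in adjacent rows, so a point is determined by its column and the parity
    of its row. This leaves [k] times 2 cells. *)
Lemma near_columns_length (alpha : R) (P : list (Z * Z)) (M : Z) (k : nat) :
  1 < alpha -> hollow3 alpha P -> NoDup P ->
  (forall p, In p P -> (fst p <= M)%Z) ->
  (length (filter (fun p => M - Z.of_nat k <? fst p)%Z P) <= 2 * k)%nat.
Proof.
  intros Halpha HP HN HM.
  set (g := fun p : Z * Z => (fst p, Z.even (snd p))).
  set (cells := list_prod (map (fun i => M - Z.of_nat i)%Z (seq 0 k)) [true; false]).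
  replace (2 * k)%nat with (length cells)
    by (unfold cells; rewrite length_prod, length_map, length_seq; simpl; lia).
  rewrite <- (length_map g); apply NoDup_incl_length.
  - apply NoDup_map_NoDup_ForallPairs; [| now apply NoDup_filter].
    intros p q Hp Hq E; apply filter_In in Hp, Hq.
    unfold g in E; injection E as E1 E2.
    pose proof (same_column alpha Halpha P p q HP (proj1 Hp) (proj1 Hq) E1) as Hd.
    destruct p as [m n], q as [m' n']; simpl in *; f_equal; [exact E1 |].
    assert (Hc : (n = n' \/ n = n' + 1 \/ n' = n + 1)%Z) by lia.
    destruct Hc as [Hc | [-> | ->]]; [exact Hc | |];
      rewrite Z.add_1_r, Z.even_succ, <- Z.negb_even in E2;
      destruct (Z.even _); discriminate.
  - intros x Hx; apply in_map_iff in Hx; destruct Hx as (p & <- & Hp).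
    apply filter_In in Hp; destruct Hp as [Hp Hlt]; apply Z.ltb_lt in Hlt.
    specialize (HM p Hp).
    apply in_prod; [| destruct (Z.even (snd p)); simpl; auto].
    apply in_map_iff; exists (Z.to_nat (M - fst p)); split; [lia |].
    apply in_seq; lia.
Qed.

(** Three distinct integers cannot be pairwise at distance at most 1. The pair is ordered from left
    to right for use in [far_not_four]. *)
Lemma row_length (alpha : R) (P l : list (Z * Z)) (n : Z) :
  1 < alpha -> hollow3 alpha P -> NoDup l -> incl l P ->
  (forall p, In p l -> snd p = n) ->
  (length l <= 1)%nat \/ exists a b, incl [a; b] l /\ length l = 2%nat /\ fst b = (fst a + 1)%Z.
Proof.
  intros Halpha HP HN Hl Hn.
  assert (Hd : forall p q, In p l -> In q l -> (Z.abs (fst p - fst q) <= 1)%Z)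
    by (intros p q Hp Hq; apply (same_row alpha Halpha P); auto;
        now rewrite (Hn p Hp), (Hn q Hq)).
  assert (Hne : forall p q, In p l -> In q l -> p <> q -> fst p <> fst q).
  { intros p q Hp Hq Hpq E; apply Hpq; pose proof (Hn p Hp); pose proof (Hn q Hq).
    destruct p, q; simpl in *; congruence. }
  destruct l as [| a [| b [| c l]]]; [left; simpl; lia | left; simpl; lia | right | exfalso].
  - inversion_clear HN as [| ? ? Hab _].
    assert (a <> b) by (intros ->; apply Hab; simpl; auto).
    pose proof (Hd a b ltac:(simpl; auto) ltac:(simpl; auto)).
    pose proof (Hne a b ltac:(simpl; auto) ltac:(simpl; auto) H).
    destruct (Z.lt_ge_cases (fst a) (fst b)); [exists a, b | exists b, a];
      (split; [intros x; simpl; tauto |]; split; [reflexivity | lia]).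
  - inversion_clear HN as [| ? ? Ha HN']; inversion_clear HN' as [| ? ? Hb _].
    assert (a <> b) by (intros ->; apply Ha; simpl; auto).
    assert (a <> c) by (intros ->; apply Ha; simpl; auto).
    assert (b <> c) by (intros ->; apply Hb; simpl; auto).
    pose proof (Hd a b ltac:(simpl; auto) ltac:(simpl; auto)).
    pose proof (Hd a c ltac:(simpl; auto) ltac:(simpl; auto)).
    pose proof (Hd b c ltac:(simpl; auto) ltac:(simpl; auto)).
    pose proof (Hne a b ltac:(simpl; auto) ltac:(simpl; auto) ltac:(assumption)).
    pose proof (Hne a c ltac:(simpl; auto) ltac:(simpl; auto) ltac:(assumption)).
    pose proof (Hne b c ltac:(simpl; auto) ltac:(simpl; auto) ltac:(assumption)).
    lia.
Qed.

Lemma hollow3_length (alpha : R) (P : list (Z * Z)) (k : nat) :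
  1 < alpha -> (0 < k)%nat -> alpha <= (alpha - 1) * powerRZ alpha (Z.of_nat k) ->
  hollow3 alpha P -> NoDup P -> (length P <= 2 * k + 3)%nat.
Proof.
  intros Halpha Hk Hak HP0 HN0.
  (* Since [k] is positive the bound is at least 5, so only sets with more than four points need
     normalising. *)
  destruct (Nat.le_gt_cases (length P) 4) as [H4 | H4]; [lia |].
  destruct (normalize_mid alpha Halpha P HP0 HN0 H4) as (Q & Hlen & HN & HP & Hmid).
  rewrite <- Hlen in H4 |- *.
  assert (HQ : Q <> []) by (destruct Q; [simpl in H4; lia | discriminate]).
  destruct (exists_max fst Q HQ) as (z & Hz & Hzmax).
  destruct (exists_max snd Q HQ) as (t & Ht & Htmax).
  set (near := fun p : Z * Z => (fst z - Z.of_nat k <? fst p)%Z).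
  set (far := filter (fun p => negb (near p)) Q).
  set (top := fun p : Z * Z => (snd p =? snd t)%Z).
  pose proof (near_columns_length alpha Q (fst z) k Halpha HP HN Hzmax) as Hnear.
  fold near in Hnear.
  pose proof (filter_length near Q) as HQlen; fold far in HQlen.
  pose proof (filter_length top far) as Hfarlen.
  assert (Hfar : forall p, In p far -> In p Q /\ (fst p + Z.of_nat k <= fst z)%Z).
  { intros p Hp; apply filter_In in Hp; destruct Hp as [Hp H]; split; [exact Hp |].
    unfold near in H; apply Bool.negb_true_iff, Z.ltb_ge in H; lia. }
  assert (HNfar : NoDup far) by now apply NoDup_filter.
  assert (Htop : forall p, In p (filter top far) -> In p far /\ snd p = snd t).
  { intros p Hp; apply filter_In in Hp; destruct Hp as [Hp H]; split; [exact Hp |].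
    now apply Z.eqb_eq in H. }
  assert (Hlow : forall p, In p (filter (fun p => negb (top p)) far) ->
            In p far /\ snd p = (snd t - 1)%Z).
  { intros p Hp; apply filter_In in Hp; destruct Hp as [Hp H]; split; [exact Hp |].
    apply Bool.negb_true_iff, Z.eqb_neq in H.
    destruct (Hfar p Hp) as [HpQ Hpz]; specialize (Htmax p HpQ).
    pose proof (far_rows alpha Halpha Q t z p (Z.of_nat k) HP Hmid Ht Hz HpQ ltac:(lia) Hak Hpz).
    lia. }
  (* Up to three far points fit the bound; the only case left is that both rows hold two. *)
  destruct (row_length alpha Q (filter top far) (snd t) Halpha HP)
    as [H1 | (a & b & Hab & H1 & Eab)];
    [now apply NoDup_filter | intros p Hp; now apply Hfar, Htop | intros p Hp; now apply Htop | |];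
    (destruct (row_length alpha Q (filter (fun p => negb (top p)) far) (snd t - 1) Halpha HP)
      as [H2 | (c & d & Hcd & H2 & Ecd)];
      [now apply NoDup_filter | intros p Hp; now apply Hfar, Hlow
       | intros p Hp; now apply Hlow | |]); try lia.
  exfalso.
  destruct (Htop a) as [Ha Ea]; [apply Hab; simpl; auto |].
  destruct (Htop b) as [Hb Eb]; [apply Hab; simpl; auto |].
  destruct (Hlow c) as [Hc Ec]; [apply Hcd; simpl; auto |].
  destruct (Hlow d) as [Hd Ed]; [apply Hcd; simpl; auto |].
  destruct (Hfar a Ha) as [HaQ _], (Hfar b Hb) as [HbQ Hbz],
    (Hfar c Hc) as [HcQ _], (Hfar d Hd) as [HdQ Hdz].
  specialize (Htmax z Hz).
  apply (far_not_four alpha Halpha Q a b c d z (Z.of_nat k)); auto; lia.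
Qed.

(** * Back from exponents to points of the plane *)

Definition emb (alpha : R) (q : Z * Z) : point := (powerRZ alpha (fst q), powerRZ alpha (snd q)).

Lemma convex_tri (C : pset) (p1 p2 p3 : point) (l1 l2 l3 : R) :
  convex C -> C p1 -> C p2 -> C p3 ->
  0 <= l1 -> 0 <= l2 -> 0 <= l3 -> l1 + l2 + l3 = 1 ->
  C (l1 * fst p1 + l2 * fst p2 + l3 * fst p3, l1 * snd p1 + l2 * snd p2 + l3 * snd p3).
Proof.
  intros HC H1 H2 H3 L1 L2 L3 Hs.
  destruct (Req_dec (l1 + l2) 0) as [H0 | H0].
  - replace l1 with 0 by lra; replace l2 with 0 by lra; replace l3 with 1 by lra.
    replace (_, _) with p3 by (destruct p3; simpl; f_equal; ring); exact H3.
  - assert (Hp : C (comb (l2 / (l1 + l2)) p1 p2)).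
    { apply HC; auto; split.
      - apply Rmult_le_pos; [lra | apply Rlt_le, Rinv_0_lt_compat; lra].
      - apply Rmult_le_reg_r with (l1 + l2); [lra |].
        replace (l2 / (l1 + l2) * (l1 + l2)) with l2 by (field; lra); lra. }
    replace (_, _) with (comb l3 (comb (l2 / (l1 + l2)) p1 p2) p3).
    + apply HC; auto; lra.
    + unfold comb; simpl; replace l3 with (1 - (l1 + l2)) by lra; f_equal; field; lra.
Qed.

Lemma list_preimage {A B : Type} (f : A -> B) (Q : A -> Prop) (l : list B) :
  (forall b, In b l -> exists a, Q a /\ b = f a) ->
  exists l', l = map f l' /\ forall a, In a l' -> Q a.
Proof.
  induction l as [| b l IH]; intros H; [exists []; simpl; tauto |].
  destruct IH as (l' & -> & HQ); [intros c Hc; apply H; now right |].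
  destruct (H b (or_introl eq_refl)) as (a & Ha & ->).
  exists (a :: l'); split; [reflexivity |]; intros c [<- | Hc]; auto.
Qed.

Lemma hollow_L2_length (alpha : R) (k : nat) (P : list point) :
  1 < alpha -> (0 < k)%nat -> alpha <= (alpha - 1) * powerRZ alpha (Z.of_nat k) ->
  NoDup P -> (forall p, In p P -> L2 alpha p) -> hollow (L2 alpha) P ->
  (length P <= 2 * k + 3)%nat.
Proof.
  intros Halpha Hk Hak HN HP Hh.
  destruct (list_preimage (emb alpha) (fun q => 0 <= fst q /\ 0 <= snd q)%Z P) as (Q & -> & HQ).
  { intros p Hp; destruct (HP p Hp) as (m & n & ->).
    exists (Z.of_nat m, Z.of_nat n); simpl; split; [lia |].
    unfold emb; simpl; now rewrite <- !pow_powerRZ. }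
  rewrite length_map; apply (hollow3_length alpha); auto; [| now apply NoDup_map_inv in HN].
  intros q p1 p2 p3 H1 H2 H3 N1 N2 N3 (l1 & l2 & l3 & L1 & L2' & L3 & Hs & Hx & Hy).
  assert (Hge : forall n, (0 <= n)%Z -> 1 <= powerRZ alpha n)
    by (intros n Hn; change 1 with (powerRZ alpha 0); now apply pw_le).
  assert (Hnn : forall n, 1 <= powerRZ alpha n -> (0 <= n)%Z).
  { intros n Hn; apply Z.nlt_ge; intros Hlt; apply (pw_lt alpha Halpha) in Hlt.
    simpl in Hlt; lra. }
  (* [hollow] tests only points of [L2], that is, nonnegative exponents. A triangle with vertices in
     the quadrant where both coordinates are at least 1 stays there, so [q] qualifies. *)
  assert (Hq : (0 <= fst q /\ 0 <= snd q)%Z).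
  { split; apply Hnn; [rewrite Hx | rewrite Hy].
    - pose proof (Hge _ (proj1 (HQ _ H1))); pose proof (Hge _ (proj1 (HQ _ H2)));
        pose proof (Hge _ (proj1 (HQ _ H3))); nra.
    - pose proof (Hge _ (proj2 (HQ _ H1))); pose proof (Hge _ (proj2 (HQ _ H2)));
        pose proof (Hge _ (proj2 (HQ _ H3))); nra. }
  assert (Hinj : forall p, q <> p -> emb alpha p <> emb alpha q).
  { assert (H : forall m n, powerRZ alpha m = powerRZ alpha n -> m = n).
    { intros m n E; destruct (Z.lt_trichotomy m n) as [Hl | [Hl | Hl]]; [| exact Hl |];
        apply (pw_lt alpha Halpha) in Hl; lra. }
    intros p Hne E; apply Hne; injection E as E1 E2; destruct p, q; simpl in *.
    f_equal; symmetry; auto. }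
  apply (Hh (emb alpha q)).
  - exists (Z.to_nat (fst q)), (Z.to_nat (snd q)).
    unfold emb; rewrite !pow_powerRZ, !Z2Nat.id by tauto; reflexivity.
  - intros C HC HA.
    unfold emb at 1; rewrite Hx, Hy.
    apply (convex_tri C (emb alpha p1) (emb alpha p2) (emb alpha p3)); auto;
      apply HA; split; auto; now apply in_map.
Qed.

(** A common bound alpha^N for the coordinates of [P] persists on the hull, and only exponents up to
    [N] respect it. *)
Lemma L2_locally_finite (alpha : R) (P : list point) :
  1 < alpha -> (forall p, In p P -> L2 alpha p) ->
  exists L, forall q, L2 alpha q -> hull (fun a => In a P) q -> In q L.
Proof.
  intros Halpha HP.
  assert (HB : exists N : nat, forall p, In p P -> fst p <= alpha ^ N /\ snd p <= alpha ^ N).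
  { induction P as [| p P IH]; [exists 0%nat; simpl; tauto |].
    destruct IH as (N & HN); [intros q Hq; apply HP; now right |].
    destruct (HP p (or_introl eq_refl)) as (m & n & ->).
    exists (m + n + N)%nat.
    assert (Hle : forall i j, (i <= j)%nat -> alpha ^ i <= alpha ^ j)
      by (intros i j Hij; apply Rle_pow; [lra | exact Hij]).
    intros q [<- | Hq]; simpl; [split; apply Hle; lia |].
    destruct (HN q Hq); pose proof (Hle N (m + n + N)%nat ltac:(lia)); split; lra. }
  destruct HB as (N & HN).
  exists (map (fun ij => (alpha ^ fst ij, alpha ^ snd ij)) (list_prod (seq 0 (S N)) (seq 0 (S N)))).
  intros q (m & n & ->) Hq.
  assert (Hbox : alpha ^ m <= alpha ^ N /\ alpha ^ n <= alpha ^ N).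
  { apply (Hq (fun p => fst p <= alpha ^ N /\ snd p <= alpha ^ N)); [| exact HN].
    intros x y t [Hx1 Hx2] [Hy1 Hy2] Ht; simpl; nra. }
  assert (Hle : forall i, alpha ^ i <= alpha ^ N -> (i <= N)%nat).
  { intros i Hi; apply Nat.nlt_ge; intros Hlt.
    pose proof (Rlt_pow alpha N i Halpha Hlt); lra. }
  apply in_map_iff; exists (m, n); split; [reflexivity |].
  destruct Hbox as [Hm Hn]; apply Hle in Hm, Hn.
  apply in_prod; apply in_seq; lia.
Qed.

(** * The ceiling of the logarithm and the final bound *)

Lemma Rceil_ge (x : R) : x <= IZR (Rceil x).
Proof. unfold Rceil; rewrite opp_IZR; destruct (base_Int_part (- x)); lra. Qed.

(** As alpha/(alpha-1) > 1, the logarithm is positive and its ceiling is a positive integer, which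
    serves as [k]. Exponentiating gives alpha/(alpha-1) <= alpha^k. *)
Lemma pow_ceil_log (alpha : R) :
  1 < alpha -> exists k : nat,
    (0 < k)%nat /\ Z.of_nat k = Rceil (logb alpha (alpha / (alpha - 1))) /\
    alpha <= (alpha - 1) * powerRZ alpha (Z.of_nat k).
Proof.
  intros Halpha.
  pose proof (Rceil_ge (logb alpha (alpha / (alpha - 1)))) as Hc.
  set (c := Rceil _) in *.
  assert (Hln : 0 < ln alpha) by (rewrite <- ln_1; apply ln_increasing; lra).
  assert (Hx : 1 < alpha / (alpha - 1)).
  { apply Rmult_lt_reg_r with (alpha - 1); [lra |].
    replace (alpha / (alpha - 1) * (alpha - 1)) with alpha by (field; lra); lra. }
  assert (Hlnx : 0 < ln (alpha / (alpha - 1)))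
    by (rewrite <- ln_1; apply ln_increasing; lra).
  assert (Hlog : 0 < logb alpha (alpha / (alpha - 1)))
    by (apply Rmult_lt_0_compat; [| apply Rinv_0_lt_compat]; lra).
  assert (Hc0 : (0 < c)%Z) by (apply lt_IZR; lra).
  exists (Z.to_nat c); rewrite Z2Nat.id by lia; repeat split; [lia |].
  assert (Hle : ln (alpha / (alpha - 1)) <= IZR c * ln alpha).
  { replace (ln (alpha / (alpha - 1))) with (logb alpha (alpha / (alpha - 1)) * ln alpha)
      by (unfold logb; field; lra).
    apply Rmult_le_compat_r; lra. }
  assert (Hpow : alpha / (alpha - 1) <= powerRZ alpha c).
  { rewrite powerRZ_Rpower by lra; unfold Rpower.
    rewrite <- (exp_ln (alpha / (alpha - 1))) by lra.
    destruct Hle as [Hl | ->]; [now apply Rlt_le, exp_increasing | lra]. }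
  replace alpha with ((alpha - 1) * (alpha / (alpha - 1))) at 1 by (field; lra).
  apply Rmult_le_compat_l; lra.
Qed.

Theorem theorem1 (alpha : R) (Halpha : 1 < alpha) :
  exists h : nat, is_helly_number (L2 alpha) h /\
    (Z.of_nat h <= 2 * Rceil (logb alpha (alpha / (alpha - 1))) + 3)%Z.
Proof.
  destruct (pow_ceil_log alpha Halpha) as (k & Hk & <- & Hak).
  destruct (helly_number_le (L2 alpha) (2 * k + 3)) as (h & Hh & Hle).
  - apply helly_property_of_hollow_bound.
    + intros P HP; now apply L2_locally_finite.
    + intros P; now apply hollow_L2_length.
  - exists h; split; [exact Hh | lia].
Qed.
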